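(* In the unidimensional platform game of the context, fix the electorate, the shock and the power mapping $\rho$. Let $G_L$ and $G_H$ be two affiliate-value distributions with the same mean, each having a positive continuous density on a compact interval contained in $(0,\infty)$. If affiliate value is more concentrated under $H$ than under $L$, then $$\underline x^H\le\underline x^L<\bar x^L\le\bar x^H.$$ Consequently, the equilibrium platform distance and both parties' (normalized) equilibrium payoffs are weakly larger under $H$. The platform distance is strictly larger under $H$ if there exists $i\in\{2,\dots,N\}$ with $x_i>x_{i-1}$ such that, for $r_i=r(\bar s_i)$, $$\big[T_{G_H}(r_i)-T_{G_L}(r_i)\big]+\big[T_{G_H}(1-r_i)-T_{G_L}(1-r_i)\big]>0.$$
   Context: There are $N\ge2$ voter types with bliss points $x_1<\cdots<x_N$ in $\mathbb R$ and shares $s_i>0$, $\sum_i s_i=1$. Put $\bar s_i=\sum_{j\ge i}s_j$. Two parties $A,B$ simultaneously choose platforms in $[x_1,x_N]$. Let $\Delta_i(x_A,x_B)=(x_B-x_i)^2-(x_A-x_i)^2$. A common shock $\epsilon$ is uniform on $[-\phi,\phi]$ with $\phi>\max_{a,b\in[x_1,x_N],\,i}|\Delta_i(a,b)|$. Vote shares are $S_A(\epsilon)=\sum_is_i\mathbf 1\{\Delta_i\ge\epsilon\}$, $S_B=1-S_A$. The power rule $\rho:[0,1]\to\mathbb R$ is strictly increasing (possibly discontinuous) with $\rho(s)+\rho(1-s)=\bar\rho$ for all $s$; $r(s)=\frac{\rho(s)-\rho(0)}{\rho(1)-\rho(0)}$. For an affiliate-value distribution $G$ on $(0,\infty)$ with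 positive finite mean and ascending quantile function $Q_G$, let $W_G(t)=\int_{1-t}^1Q_G(u)\,du$ and $T_G(t)=W_G(t)/W_G(1)$, $t\in[0,1]$. For two distributions with the same mean, affiliate value is more concentrated under $H$ than under $L$ if $T_{G_H}(t)\ge T_{G_L}(t)$ for every $t\in[0,1]$. For $\ell\in\{L,H\}$, party payoffs under $\ell$ are $V_p^\ell=\mathbb E_\epsilon[\nu_\ell(S_p(\epsilon))]$ with $\nu_\ell(s)=T_{G_\ell}(r(s))$ (so $\nu_\ell(0)=0$, $\nu_\ell(1)=1$). The game under $\ell$ has pure-strategy Nash equilibria, and in every one of them one party offers $\underline x^\ell$ and the other $\bar x^\ell>\underline x^\ell$, where, with $\underline s_i=\sum_{j\le i}s_j$ and $\underline s_0=\bar s_{N+1}=0$, $\underline x^\ell=\sum_i[\nu_\ell(\underline s_i)-\nu_\ell(\underline s_{i-1})]x_i$ and $\bar x^\ell=\sum_i[\nu_\ell(\bar s_i)-\nu_\ell(\bar s_{i+1})]x_i$. Equilibrium platform distance is $\bar x^\ell-\underline x^\ell$. *)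

(* Defs.v *)
From HB Require Import structures.
From mathcomp Require Import all_boot all_order all_algebra.
From mathcomp Require Import all_classical all_reals all_analysis.

Set Implicit Arguments.
Unset Strict Implicit.
Unset Printing Implicit Defensive.

Import Order.TTheory GRing.Theory Num.Theory.
Import numFieldNormedType.Exports.

Local Open Scope classical_set_scope.
Local Open Scope ring_scope.

Section affiliate_value.
Context {R : realType}.
Implicit Types G : probability (measurableTypeR R) R.

(* At u = 0 the set is all of R, and at u = 1 it may be empty; [inf] is then the
   junk value 0.  These two points do not affect the integrals below. *)
Definition quantile G (u : R) : R :=
  inf [set y : R | (u%:E <= G `]-oo, y]%classic)%E].

(* [\int] is the real-valued integral: it is the genuine one as soon as the
   quantile function is integrable on [0, 1], i.e. G has a finite mean. *)
Definition top_value G (t : R) : R :=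
  \int[lebesgue_measure]_(u in `[1 - t, 1]) quantile G u.

Definition top_share G (t : R) : R := top_value G t / top_value G 1.

Definition mean G : \bar R := 'E_G[idfun]%E.

Definition affiliate_distribution G : Prop :=
  G `]0%R, +oo[%classic = 1%E /\ (0 < mean G < +oo)%E.

Definition has_positive_continuous_density G : Prop :=
  exists a b : R, exists f : R -> R,
    [/\ 0 < a, a < b,
        {within `[a, b], continuous f},
        forall y, y \in `[a, b] -> 0 < f y &
        forall A : set (measurableTypeR R), measurable A ->
          G A = (\int[lebesgue_measure]_(y in A `&` `[a, b]%classic) (f y)%:E)%E].

Definition more_concentrated GH GL : Prop :=
  forall t, t \in `[0, 1] -> top_share GL t <= top_share GH t.

End affiliate_value.

Section power.
Context {R : realType}.
Implicit Types rho : R -> R.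

(* Only the values of rho on [0, 1] are constrained, and only those matter. *)
Definition power_rule rho : Prop :=
  {in `[0, 1] &, {homo rho : s t / s < t}} /\
  exists rhobar, forall s, s \in `[0, 1] -> rho s + rho (1 - s) = rhobar.

Definition rel_power rho (s : R) : R :=
  (rho s - rho 0) / (rho 1 - rho 0).

Definition party_value (G : probability (measurableTypeR R) R) rho (s : R) : R :=
  top_share G (rel_power rho s).

End power.

(* Types are numbered from 0: [x i] is the bliss point x_(i+1) and [s i] the
   share s_(i+1), so the extreme bliss points are [x ord0] and [x ord_max]. *)
Section platform_game.
Context {R : realType} {n : nat}.
Variables x s : 'I_n.+1 -> R.

Definition delta (i : 'I_n.+1) (a b : R) : R :=
  (b - x i) ^+ 2 - (a - x i) ^+ 2.

Definition vote_share_A (a b e : R) : R := \sum_(i < n.+1 | e <= delta i a b) s i.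

Definition vote_share_B (a b e : R) : R := 1 - vote_share_A a b e.

Definition platforms : set R := `[x ord0, x ord_max].

(* [lower_share k] is the total share of the first k types. *)
Definition lower_share (k : nat) : R := \sum_(i < n.+1 | (i < k)%N) s i.

(* [upper_share k] is the total share of all types but the first k. *)
Definition upper_share (k : nat) : R := \sum_(i < n.+1 | (k <= i)%N) s i.

Variable nu : R -> R.

Definition x_low : R :=
  \sum_(i < n.+1) (nu (lower_share i.+1) - nu (lower_share i)) * x i.

Definition x_high : R :=
  \sum_(i < n.+1) (nu (upper_share i) - nu (upper_share i.+1)) * x i.

Definition platform_distance : R := x_high - x_low.

Variables (phi : R) (phi_gt0 : 0 < phi).

Definition shock : probability (measurableTypeR R) R :=
  uniform_prob (gtrN phi_gt0).

Definition payoff_A (a b : R) : \bar R :=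
  'E_shock[fun e => nu (vote_share_A a b e)]%E.

Definition payoff_B (a b : R) : \bar R :=
  'E_shock[fun e => nu (vote_share_B a b e)]%E.

Definition nash (a b : R) : Prop :=
  [/\ platforms a, platforms b,
      forall a', platforms a' -> (payoff_A a' b <= payoff_A a b)%E &
      forall b', platforms b' -> (payoff_B a b' <= payoff_B a b)%E].

End platform_game.

(* Main.v *)
Require Import Defs.
From HB Require Import structures.
From mathcomp Require Import all_boot all_order all_algebra.
From mathcomp Require Import all_classical all_reals all_analysis.
From mathcomp Require Import measurable_realfun.
From mathcomp Require Import ring lra.

Set Implicit Arguments.
Unset Strict Implicit.
Unset Printing Implicit Defensive.

Import Order.TTheory GRing.Theory Num.Theory.
Import numFieldNormedType.Exports.

Local Open Scope classical_set_scope.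
Local Open Scope ring_scope.

(** For platforms a <= b, type i prefers A when the shock is below delta_i, which is
    nonincreasing in i, so A wins a lower segment of types and its expected value is
    affine in the delta_i with weights nu(low_i+1) - nu(low_i).  As delta_i is affine in
    x_i, each party is evaluated as if facing a single voter located at x_low when it
    stands on the left and at x_high when it stands on the right, which leaves
    {x_low, x_high} as the only equilibria.  Summation by parts gives
    x_high - x_low = sum_i (nu(up_i) + nu(low_i) - 1) (x_i - x_(i-1)), and likewise for
    each platform, so everything is monotone in nu.  Positivity of the distance is
    T(t) + T(1 - t) > 1: the top t-fraction outweighs the bottom one. *)

(** * Quantile function of a distribution with a density *)

Lemma density_bounds (R : realType) (G : probability (measurableTypeR R) R) :
  has_positive_continuous_density G ->
  exists a b M : R,
    [/\ 0 < a, 0 < M, G `]-oo, b]%classic = 1%E,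
        forall y, y < a -> G `]-oo, y]%classic = 0%E &
        forall y z, y <= z -> (G `]y, z]%classic <= (M * (z - y))%:E)%E].
Proof.
move=> [a [b [f [a0 ab cf f0 GE]]]].
have [c cab fc] := EVT_max (ltW ab) cf.
have mf : measurable_fun `[a, b]%classic f by exact: subspace_continuous_measurable_fun.
(* The maximum [f c] of the density serves as a Lipschitz constant of the cdf. *)
exists a, b, (f c); split => //.
- exact: f0.
- rewrite -(probability_setT G) !GE//.
  congr (integral _ _ _); apply/seteqP; split=> z /=; rewrite !in_itv/= => -[] //.
  by move=> _ /andP[-> ->].
- move=> y ya; rewrite GE// (_ : _ `&` _ = set0) ?integral_set0//.
  apply/seteqP; split => // z []; rewrite /= !in_itv/= => zy /andP[az _].
  by move: (le_lt_trans (le_trans az zy) ya); rewrite ltxx.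
- move=> y z yz; rewrite GE//.
  have mD : measurable (`]y, z]%classic `&` `[a, b]%classic : set (measurableTypeR R)).
    exact: measurableI.
  apply: (@le_trans _ _
    (\int[lebesgue_measure]_(t in `]y, z]%classic `&` `[a, b]) (f c)%:E)%E).
    apply: ge0_le_integral => //.
    + by move=> t [_ tab]; rewrite lee_fin ltW// f0.
    + by apply/measurable_EFinP; apply: measurable_funS mf => // t [].
    + by move=> t [_ tab]; rewrite lee_fin fc.
  rewrite integral_cst// EFinM lee_pmul2l//; last by rewrite lte_fin f0.
  rewrite (@le_trans _ _ (lebesgue_measure `]y, z]%classic))//.
    by rewrite le_measure ?inE//; apply: subIsetl.
  by rewrite lebesgue_measure_itv/= lte_fin; case: ltgtP yz => //= -> _; rewrite subrr.
Qed.

Lemma le_cdf (R : realType) (G : probability (measurableTypeR R) R) (y z : R) :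
  y <= z -> (G `]-oo, y]%classic <= G `]-oo, z]%classic)%E.
Proof.
by move=> yz; rewrite le_measure ?inE//; apply: subset_itvl; rewrite bnd_simp.
Qed.

(** For positive [u] the set defining the quantile contains [b] and is bounded below by [a], so its
    [inf] is genuine. *)
Lemma quantile_has_inf (R : realType) (G : probability (measurableTypeR R) R)
    (a b u : R) :
  G `]-oo, b]%classic = 1%E -> (forall y, y < a -> G `]-oo, y]%classic = 0%E) ->
  0 < u <= 1 ->
  [/\ (u%:E <= G `]-oo, b]%classic)%E &
   lbound [set y : R | (u%:E <= G `]-oo, y]%classic)%E] a].
Proof.
move=> Gb Ga /andP[u0 u1]; split; first by rewrite Gb lee_fin.
move=> y /= uy; rewrite leNgt; apply/negP => ya.
by move: uy; rewrite Ga// lee_fin leNgt u0.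
Qed.

(** The defining set is the whole line, so [inf] returns its default. As the support is positive,
    this default keeps the quantile nondecreasing on the closed interval [0, 1]. *)
Lemma quantile0 (R : realType) (G : probability (measurableTypeR R) R) :
  quantile G 0 = 0.
Proof.
apply: inf_out => -[_ [l lb]].
by have := lb (l - 1) (measure_ge0 G _); lra.
Qed.

Lemma quantile_bounds (R : realType) (G : probability (measurableTypeR R) R)
    (a b u : R) :
  G `]-oo, b]%classic = 1%E -> (forall y, y < a -> G `]-oo, y]%classic = 0%E) ->
  0 < u <= 1 -> a <= quantile G u <= b.
Proof.
move=> Gb Ga /(quantile_has_inf Gb Ga)[ub lb]; apply/andP; split.
  by apply: lb_le_inf => //; exists b.
by apply: ge_inf => //; exists a.
Qed.

Lemma le_quantile (R : realType) (G : probability (measurableTypeR R) R) :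
  has_positive_continuous_density G ->
  {in `[0, 1] &, {homo quantile G : u v / u <= v}}.
Proof.
move=> /density_bounds[a [b [M [a0 _ Gb Ga _]]]] u v.
rewrite !in_itv/= => /andP[u0 u1] /andP[v0 v1].
rewrite [0 <= u]le_eqVlt in u0; move: u0 => /predU1P[<- _|u0 uv].
  rewrite quantile0.
  rewrite [0 <= v]le_eqVlt in v0; move: v0 => /predU1P[<-|v0]; rewrite ?quantile0//.
  have /andP[+ _] := quantile_bounds Gb Ga (introT andP (conj v0 v1)).
  exact/le_trans/ltW.
have [vb _] := quantile_has_inf Gb Ga (introT andP (conj (lt_le_trans u0 uv) v1)).
apply: lb_le_inf; first by exists b.
move=> y /= vy; apply: ge_inf; last by apply: le_trans vy; rewrite lee_fin.
have [_ lb] := quantile_has_inf Gb Ga (introT andP (conj u0 u1)).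
by exists a.
Qed.

(* The cdf is Lipschitz, because the density is bounded, so it has no jump and the
   quantile function no flat piece. *)
Lemma lt_quantile (R : realType) (G : probability (measurableTypeR R) R) :
  has_positive_continuous_density G ->
  {in `]0, 1] &, {homo quantile G : u v / u < v}}.
Proof.
move=> /density_bounds[a [b [M [a0 M0 Gb Ga GM]]]] u v.
rewrite !in_itv/= => u01 v01 uv; rewrite ltNge; apply/negP => Qvu.
have [ub lbu] := quantile_has_inf Gb Ga u01.
have [vb lbv] := quantile_has_inf Gb Ga v01.
(* The choice makes 2 M d = v - u. A point [z] less than d above Q(v) has cdf at least v, and [y],
   at d below Q(u), has cdf less than u. If Q(v) <= Q(u), then ]y, z] is shorter than 2 d yet has
   mass more than v - u. *)
pose d := (v - u) / (M *+ 2).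
have d0 : 0 < d by rewrite divr_gt0 ?subr_gt0// mulrn_wgt0.
have [|z /= vz zQ] := inf_adherent d0
  (_ : has_inf [set y : R | (v%:E <= G `]-oo, y]%classic)%E]).
  by split; [exists b|exists a].
rewrite -/(quantile G v) in zQ.
pose y := quantile G u - d.
have yu : (G `]-oo, y]%classic < u%:E)%E.
  rewrite ltNge; apply/negP => uy.
  have : quantile G u <= y by apply: ge_inf => //; exists a.
  by rewrite /y; lra.
have yz : y <= z.
  rewrite leNgt; apply/negP => /ltW/(le_cdf G) zy.
  have := le_lt_trans (le_trans vz zy) yu; rewrite lte_fin; lra.
have Gz : (G `]-oo, z]%classic = G `]-oo, y]%classic + G `]y, z]%classic)%E.
  rewrite -measureU//; first by rewrite -itv_bndbnd_setU// bnd_simp.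
  apply/seteqP; split => // t [] /=; rewrite !in_itv/= => ty /andP[yt _].
  by move: (lt_le_trans yt ty); rewrite ltxx.
have : (v%:E < u%:E + (M * (z - y))%:E)%E.
  by rewrite (le_lt_trans vz)// Gz lte_leD// ?GM// fin_num_measure.
rewrite -EFinD lte_fin -ltrBlDl ltNge => /negP; apply.
have -> : v - u = M * (d + d) by rewrite /d; field; lra.
by rewrite ler_pM2l// /y; lra.
Qed.

(** * Integrals of nondecreasing functions on an interval *)

Lemma nondecreasing_integrable (R : realType) (g : R -> R) (c d : R) :
  {in `[c, d] &, {homo g : u v / u <= v}} ->
  lebesgue_measure.-integrable `[c, d]%classic (EFin \o g).
Proof.
move=> gnd; have [dc|cd] := ltP d c.
  by rewrite set_itv_ge ?bnd_simp -?ltNge//; exact: integrable_set0.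
have cin : c \in `[c, d] by rewrite in_itv/= lexx.
have din : d \in `[c, d] by rewrite in_itv/= lexx cd.
apply: measurable_bounded_integrable => //.
- by rewrite /= lebesgue_measure_itv/=; case: ifP => // _; rewrite -EFinB ltry.
(* Composing with the projection onto [c, d] extends g to a function monotone on the whole line,
   hence measurable. *)
- pose clamp (u : R) := Order.min d (Order.max c u).
  have clampP u : clamp u \in `[c, d].
    by rewrite in_itv/= /clamp le_min ge_min cd !le_max !lexx.
  apply: (@eq_measurable_fun _ _ _ _ _ (g \o clamp)).
    move=> u; rewrite inE/= in_itv/= => /andP[cu ud].
    by rewrite /clamp max_r// min_r.
  apply: nondecreasing_measurable => // u v uv; apply: gnd => //.
  by rewrite /clamp le_min2// le_max2.
- exists (`|g c| + `|g d|); split => // K KM u /= ucd; apply: le_trans (ltW KM).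
  have := ucd; rewrite in_itv/= => /andP[cu ud].
  rewrite ler_norml; apply/andP; split.
    apply: le_trans (gnd _ _ cin ucd cu).
    have := ler_norm (- g c); have := normr_ge0 (g d); rewrite normrN; lra.
  apply: le_trans (gnd _ _ ucd din ud) _.
  have := ler_norm (g d); have := normr_ge0 (g c); lra.
Qed.

Lemma nondecreasing_Rintegral_bounds (R : realType) (g : R -> R) (c d : R) :
  c <= d -> {in `[c, d] &, {homo g : u v / u <= v}} ->
  (d - c) * g c <= \int[lebesgue_measure]_(u in `[c, d]) g u <= (d - c) * g d.
Proof.
move=> cd gnd; have ig := nondecreasing_integrable gnd.
have cin : c \in `[c, d] by rewrite in_itv/= lexx.
have din : d \in `[c, d] by rewrite in_itv/= lexx cd.
have cstE (k : R) :
    \int[lebesgue_measure]_(u in `[c, d]) k = (d - c) * k.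
  rewrite Rintegral_cst// mulrC; congr (_ * _).
  rewrite /= lebesgue_measure_itv/= lte_fin.
  by move: cd; rewrite le_eqVlt => /predU1P[->|->]; rewrite ?ltxx ?subrr.
have icst (k : R) :
    lebesgue_measure.-integrable `[c, d]%classic (EFin \o (fun=> k)).
  by apply: nondecreasing_integrable => u v.
by apply/andP; split; rewrite -cstE le_Rintegral// => u ucd; apply: gnd => //;
  move: ucd; rewrite /= in_itv/= => /andP[].
Qed.

Lemma Rintegral_itv_split (R : realType) (g : R -> R) (c d e : R) :
  c <= d -> d <= e -> {in `[c, e] &, {homo g : u v / u <= v}} ->
  \int[lebesgue_measure]_(u in `[c, e]) g u =
  \int[lebesgue_measure]_(u in `[c, d]) g u +
  \int[lebesgue_measure]_(u in `[d, e]) g u.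
Proof.
move=> cd de gnd; have ig := nondecreasing_integrable gnd.
have gnd' : {in `[d, e] &, {homo g : u v / u <= v}}.
  by apply: sub_in2 gnd => u; apply: subitvPl; rewrite bnd_simp.
rewrite -[X in _ + X]Rintegral_itv_obnd_cbnd; last first.
  apply: integrableS (nondecreasing_integrable gnd') => //.
  by apply: subset_itvr; rewrite bnd_simp.
by rewrite -(Rintegral_itvB ig) ?bnd_simp// addrC subrK.
Qed.

(** * Top values and top shares *)

Lemma quantile_sub (R : realType) (G : probability (measurableTypeR R) R) (c d : R) :
  has_positive_continuous_density G -> 0 <= c -> d <= 1 ->
  {in `[c, d] &, {homo quantile G : u v / u <= v}}.
Proof.
move=> /le_quantile Gnd c0 d1; apply: sub_in2 Gnd => u.
by apply: subitvP; rewrite subitvE !bnd_simp c0 d1.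
Qed.

Lemma top_value_split (R : realType) (G : probability (measurableTypeR R) R) (t t' : R) :
  has_positive_continuous_density G -> 0 <= t -> t <= t' -> t' <= 1 ->
  top_value G t' =
  \int[lebesgue_measure]_(u in `[1 - t', 1 - t]) quantile G u + top_value G t.
Proof.
move=> Gd t0 tt' t'1; apply: Rintegral_itv_split; [lra|lra|].
by apply: quantile_sub => //; lra.
Qed.

Lemma top_value0 (R : realType) (G : probability (measurableTypeR R) R) :
  top_value G 0 = 0.
Proof. by rewrite /top_value subr0 set_itv1 Rintegral_set1. Qed.

Lemma quantile_ge0 (R : realType) (G : probability (measurableTypeR R) R) (u : R) :
  has_positive_continuous_density G -> 0 <= u <= 1 -> 0 <= quantile G u.
Proof.
move=> Gd /andP[u0 u1]; rewrite -(quantile0 G).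
by apply: le_quantile => //; rewrite in_itv/= ?lexx ?ler01 ?u0.
Qed.

Lemma le_top_value (R : realType) (G : probability (measurableTypeR R) R) :
  has_positive_continuous_density G ->
  {in `[0, 1] &, {homo top_value G : t t' / t <= t'}}.
Proof.
move=> Gd t t'; rewrite !in_itv/= => /andP[t0 t1] /andP[t'0 t'1] tt'.
rewrite (top_value_split Gd t0 tt' t'1) lerDr; apply: Rintegral_ge0 => u.
rewrite /= in_itv/= => /andP[u1 u2].
by apply: quantile_ge0 => //; apply/andP; split; lra.
Qed.

Lemma top_value1_gt0 (R : realType) (G : probability (measurableTypeR R) R) :
  has_positive_continuous_density G -> 0 < top_value G 1.
Proof.
move=> Gd; have [a [b [M [a0 _ Gb Ga _]]]] := density_bounds Gd.
(* On [0, 1] the bound by the left endpoint is useless, since the quantile at 0 is 0. On [1/2, 1]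
   the quantile is at least a > 0. *)
apply: (@lt_le_trans _ _ (top_value G 2^-1)); last first.
  by apply: le_top_value => //; rewrite ?in_itv/=; try (apply/andP; split); lra.
have [h0 h1] : 0 <= 1 - 2^-1 :> R /\ 1 - 2^-1 <= 1 :> R by split; lra.
have h2 : 0 < 1 - 2^-1 :> R by lra.
have := nondecreasing_Rintegral_bounds h1 (quantile_sub Gd h0 (lexx 1)).
rewrite -/(top_value G _) => /andP[+ _]; apply: lt_le_trans.
have /andP[aQ _] := quantile_bounds Gb Ga (introT andP (conj h2 h1)).
apply: mulr_gt0; last exact: lt_le_trans aQ.
by rewrite subKr invr_gt0.
Qed.

(** Removing W(1 - t) from both sides leaves the integral of Q over [0, t] against its integral over
    [1 - t, 1]. For t <= 1/2 the former is less than t Q(t), and the latter is at least t Q(1 - t)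
    >= t Q(t). *)
Lemma top_value_complement (R : realType) (G : probability (measurableTypeR R) R)
    (t : R) :
  has_positive_continuous_density G -> 0 < t < 1 ->
  top_value G 1 < top_value G t + top_value G (1 - t).
Proof.
move=> Gd; wlog t_half : t / t <= 2^-1.
  move=> H /andP[t0 t1]; have [/H|/ltW t_half] := leP t 2^-1.
    by apply; rewrite t0 t1.
  have t'_half : 1 - t <= 2^-1 by lra.
  have t'01 : 0 < 1 - t < 1 by apply/andP; split; lra.
  by have := H _ t'_half t'01; rewrite subKr addrC.
move=> /andP[t0 t1].
(* Cutting [0, t] at its midpoint makes the comparison strict: on the first half Q is at most Q(t /
   2), which is less than Q(t). *)
have [t2 t2t t1' t'1] : [/\ 0 <= t / 2, t / 2 <= t, 0 <= 1 - t & 1 - t <= 1].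
  by split; lra.
have gnd c d : 0 <= c -> d <= 1 -> {in `[c, d] &, {homo quantile G : u v / u <= v}}.
  exact: quantile_sub.
have t_le1 := ltW t1; have t2_le1 := le_trans t2t t_le1.
have Gt : top_value G 1 = \int[lebesgue_measure]_(u in `[0, t / 2]) quantile G u +
    \int[lebesgue_measure]_(u in `[t / 2, t]) quantile G u + top_value G (1 - t).
  rewrite (top_value_split Gd t1' t'1 (lexx 1)) subrr subKr.
  by rewrite (Rintegral_itv_split t2 t2t (gnd _ _ (lexx 0) t_le1)).
rewrite Gt ltrD2r /top_value.
have /andP[_ H1] := nondecreasing_Rintegral_bounds t2 (gnd _ _ (lexx 0) t2_le1).
have /andP[_ H2] := nondecreasing_Rintegral_bounds t2t (gnd _ _ t2 t_le1).
have /andP[H3 _] := nondecreasing_Rintegral_bounds t'1 (gnd _ _ t1' (lexx 1)).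
have Q1 : quantile G (t / 2) < quantile G t.
  have [t2_gt0 t2_lt] : 0 < t / 2 /\ t / 2 < t by split; lra.
  by apply: lt_quantile => //; rewrite in_itv/= ?t2_gt0 ?t0.
have Q2 : quantile G t <= quantile G (1 - t).
  have tt' : t <= 1 - t by lra.
  by apply: le_quantile => //; rewrite in_itv/= ?t1' ?(ltW t0).
apply: le_lt_trans (lerD H1 H2) _; apply: lt_le_trans H3.
have := ltr_pM2l t0 (quantile G (t / 2)) (quantile G t).
have := ler_pM2l t0 (quantile G t) (quantile G (1 - t)).
by rewrite Q1 Q2; lra.
Qed.

Lemma top_share0 (R : realType) (G : probability (measurableTypeR R) R) :
  top_share G 0 = 0.
Proof. by rewrite /top_share top_value0 mul0r. Qed.

Lemma top_share1 (R : realType) (G : probability (measurableTypeR R) R) :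
  has_positive_continuous_density G -> top_share G 1 = 1.
Proof. by move=> Gd; rewrite /top_share divff// gt_eqF// top_value1_gt0. Qed.

Lemma le_top_share (R : realType) (G : probability (measurableTypeR R) R) :
  has_positive_continuous_density G ->
  {in `[0, 1] &, {homo top_share G : t t' / t <= t'}}.
Proof.
move=> Gd t t' t01 t'01 tt'.
by rewrite ler_pM2r ?invr_gt0 ?top_value1_gt0// le_top_value.
Qed.

Lemma top_share_complement (R : realType) (G : probability (measurableTypeR R) R)
    (t : R) :
  has_positive_continuous_density G -> 0 < t < 1 ->
  1 < top_share G t + top_share G (1 - t).
Proof.
move=> Gd t01.
by rewrite -mulrDl ltr_pdivlMr ?mul1r ?top_value1_gt0// top_value_complement.
Qed.

(** * Relative power *)

Lemma rel_power_bounds (R : realType) (rho : R -> R) (s : R) :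
  power_rule rho -> 0 <= s <= 1 -> 0 <= rel_power rho s <= 1.
Proof.
move=> [rho_incr _] s01; have s_in : s \in `[0, 1] by rewrite in_itv.
have in0 : (0 : R) \in `[0, 1] by rewrite in_itv/= lexx ler01.
have in1 : (1 : R) \in `[0, 1] by rewrite in_itv/= lexx ler01.
have r01 : 0 < rho 1 - rho 0 by rewrite subr_gt0 rho_incr.
have rho_nd u v : u \in `[0, 1] -> v \in `[0, 1] -> u <= v -> rho u <= rho v.
  by move=> ui vi; rewrite le_eqVlt => /predU1P[->//|/(rho_incr _ _ ui vi)/ltW].
move: s01 => /andP[s0 s1].
rewrite /rel_power divr_ge0 ?(ltW r01) ?subr_ge0 ?rho_nd//=.
by rewrite ler_pdivrMr// mul1r lerD2r rho_nd.
Qed.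

Lemma lt_rel_power (R : realType) (rho : R -> R) :
  power_rule rho -> {in `[0, 1] &, {homo rel_power rho : s t / s < t}}.
Proof.
move=> [rho_incr _] s t si ti st.
rewrite ltr_pM2r ?invr_gt0 ?subr_gt0 ?rho_incr ?ltr01// ?in_itv/= ?lexx ?ler01//.
by rewrite ltrD2r rho_incr.
Qed.

Lemma rel_power0 (R : realType) (rho : R -> R) : rel_power rho 0 = 0.
Proof. by rewrite /rel_power subrr mul0r. Qed.

Lemma rel_power1 (R : realType) (rho : R -> R) :
  power_rule rho -> rel_power rho 1 = 1.
Proof.
move=> [rho_incr _]; rewrite /rel_power divff// gt_eqF// subr_gt0.
by rewrite rho_incr ?ltr01// in_itv/= lexx ler01.
Qed.

(** The constant-sum identity is used at [s] and at 0, which gives rho(s) + rho(1 - s) = rho(0) +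
    rho(1). *)
Lemma rel_power_complement (R : realType) (rho : R -> R) (s : R) :
  power_rule rho -> 0 <= s <= 1 -> rel_power rho (1 - s) = 1 - rel_power rho s.
Proof.
move=> rho_power s01; rewrite -[in RHS](rel_power1 rho_power).
case: rho_power => _ [rhobar rhoC].
rewrite /rel_power -mulrBl; congr (_ / _).
have := rhoC s s01; have := rhoC 0; rewrite in_itv/= lexx ler01 subr0 => /(_ isT).
lra.
Qed.

(** * Cumulative shares of types *)

Lemma lower_shareS (R : realType) (n : nat) (s : 'I_n.+1 -> R) (i : 'I_n.+1) :
  lower_share s i.+1 = lower_share s i + s i.
Proof.
rewrite /lower_share (bigD1 i)//= addrC; congr (_ + _); apply: eq_bigl => j.
by rewrite ltnS andbC -val_eqE/= -ltn_neqAle.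
Qed.

Lemma lower_upper_share (R : realType) (n : nat) (s : 'I_n.+1 -> R) (k : nat) :
  \sum_i s i = 1 -> upper_share s k = 1 - lower_share s k.
Proof.
move=> <-; rewrite (bigID (fun i : 'I_n.+1 => (i < k)%N))/= addrAC subrr add0r.
by apply: eq_bigl => i; rewrite -leqNgt.
Qed.

Lemma lower_share0 (R : realType) (n : nat) (s : 'I_n.+1 -> R) :
  lower_share s 0 = 0.
Proof. by rewrite /lower_share big_pred0. Qed.

Lemma lower_share_full (R : realType) (n : nat) (s : 'I_n.+1 -> R) :
  lower_share s n.+1 = \sum_i s i.
Proof. by apply: eq_bigl => i; rewrite ltn_ord. Qed.

Lemma le_lower_share (R : realType) (n : nat) (s : 'I_n.+1 -> R) (k l : nat) :
  (forall i, 0 < s i) -> (k <= l)%N -> lower_share s k <= lower_share s l.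
Proof.
move=> s0 kl; rewrite /lower_share [X in X <= _]big_mkcond [X in _ <= X]big_mkcond/=.
apply: ler_sum => i _; case: ifPn => [ik|_]; first by rewrite (leq_trans ik).
by case: ifP => // _; exact: ltW.
Qed.

Lemma lower_share_bounds (R : realType) (n : nat) (s : 'I_n.+1 -> R) (k : nat) :
  (forall i, 0 < s i) -> \sum_i s i = 1 -> 0 <= lower_share s k <= 1.
Proof.
move=> s0 s1; apply/andP; split; first by apply: sumr_ge0 => i _; exact: ltW.
rewrite -s1 /lower_share [X in X <= _]big_mkcond/=.
by apply: ler_sum => i _; case: ifP => // _; exact: ltW.
Qed.

Lemma lower_share_interior (R : realType) (n : nat) (s : 'I_n.+1 -> R) (k : nat) :
  (forall i, 0 < s i) -> \sum_i s i = 1 -> (0 < k < n.+1)%N ->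
  0 < lower_share s k < 1.
Proof.
move=> s0 s1 /andP[k0 kn]; apply/andP; split.
  apply: lt_le_trans (le_lower_share s0 k0).
  by rewrite (lower_shareS s ord0) lower_share0 add0r.
have := le_lower_share s0 kn; rewrite lower_share_full s1; apply: lt_le_trans.
by rewrite (lower_shareS s (Ordinal kn)) ltrDl.
Qed.

(** * Values of lower and upper segments of types *)

(** The bound k is the least index from which P fails throughout. By minimality P holds somewhere at
    or after k - 1, hence everywhere below k. *)
Lemma initial_segment (n : nat) (P : pred 'I_n) :
  (forall i j : 'I_n, (i <= j)%N -> P j -> P i) ->
  exists2 k, (k <= n)%N & forall i, P i = (i < k)%N.
Proof.
move=> Pdown.
have ex_k : exists k, [forall i : 'I_n, (k <= i)%N ==> ~~ P i].
  by exists n; apply/forallP => i; rewrite leqNgt ltn_ord.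
have [k /forallP Pk kmin] := ex_minnP ex_k; exists k.
  by apply: kmin; apply/forallP => i; rewrite leqNgt ltn_ord.
move=> i; have [ik|ki] := ltnP i k; last by apply: negbTE; have := Pk i; rewrite ki.
case: k {Pk} kmin ik => // k kmin; rewrite ltnS => ik.
have : ~~ [forall i : 'I_n, (k <= i)%N ==> ~~ P i].
  by apply/negP => /kmin; rewrite ltnn.
rewrite negb_forall => /existsP[j]; rewrite negb_imply negbK => /andP[kj].
exact/Pdown/(leq_trans ik).
Qed.

(** The increments of [nu] telescope up to the end of the segment. The gain is that the value
    becomes linear in the indicators of the types, with weights independent of the segment. *)
Lemma value_lower_segment (R : realType) (n : nat) (s : 'I_n.+1 -> R)
    (nu : R -> R) (P : pred 'I_n.+1) :
  nu 0 = 0 -> (forall i j : 'I_n.+1, (i <= j)%N -> P j -> P i) ->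
  nu (\sum_(i | P i) s i) =
  \sum_(i < n.+1) (nu (lower_share s i.+1) - nu (lower_share s i)) * (P i)%:R.
Proof.
move=> nu0 /initial_segment[k kn Pk].
rewrite (eq_bigl _ _ Pk) -/(lower_share s k).
transitivity (\sum_(i < n.+1 | (i < k)%N)
    (nu (lower_share s i.+1) - nu (lower_share s i))); last first.
  rewrite big_mkcond/=; apply: eq_bigr => i _; rewrite Pk.
  by case: ifP; rewrite ?mulr1 ?mulr0.
rewrite -(big_ord_widen _ (fun i => nu (lower_share s i.+1) - nu (lower_share s i)))//.
rewrite -(big_mkord xpredT (fun i => nu (lower_share s i.+1) - nu (lower_share s i))).
by rewrite telescope_sumr// lower_share0 nu0 subr0.
Qed.

Lemma sum_lower_weights (R : realType) (n : nat) (s : 'I_n.+1 -> R) (nu : R -> R) :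
  \sum_i s i = 1 -> nu 0 = 0 -> nu 1 = 1 ->
  \sum_(i < n.+1) (nu (lower_share s i.+1) - nu (lower_share s i)) = 1.
Proof.
move=> s1 nu0 nu1; rewrite -[RHS]nu1 -s1 (value_lower_segment s (P := xpredT))//.
by apply: eq_bigr => i _; rewrite mulr1.
Qed.

(* Complementing shares turns upper segments into lower ones. *)
Definition dual_value (R : realType) (nu : R -> R) (y : R) : R := 1 - nu (1 - y).

Lemma upper_weightE (R : realType) (n : nat) (s : 'I_n.+1 -> R) (nu : R -> R) (k : nat) :
  \sum_i s i = 1 ->
  nu (upper_share s k) - nu (upper_share s k.+1) =
  dual_value nu (lower_share s k.+1) - dual_value nu (lower_share s k).
Proof.
move=> s1; rewrite !lower_upper_share// /dual_value; lra.
Qed.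

(** Reduces facts on [x_high] to facts on [x_low], which are proved for a general [nu]. *)
Lemma x_high_dual (R : realType) (n : nat) (x s : 'I_n.+1 -> R) (nu : R -> R) :
  \sum_i s i = 1 -> x_high x s nu = x_low x s (dual_value nu).
Proof. by move=> s1; apply: eq_bigr => i _; rewrite upper_weightE. Qed.

Lemma dual_value0 (R : realType) (nu : R -> R) : nu 1 = 1 -> dual_value nu 0 = 0.
Proof. by move=> nu1; rewrite /dual_value subr0 nu1 subrr. Qed.

Lemma dual_value1 (R : realType) (nu : R -> R) : nu 0 = 0 -> dual_value nu 1 = 1.
Proof. by move=> nu0; rewrite /dual_value subrr nu0 subr0. Qed.

(** The complement is a lower segment, so its value under [dual_value nu] is a weighted sum of
    indicators. Since the weights add up to 1, subtracting from 1 turns each indicator into its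
    negation. *)
Lemma value_upper_segment (R : realType) (n : nat) (s : 'I_n.+1 -> R)
    (nu : R -> R) (P : pred 'I_n.+1) :
  \sum_i s i = 1 -> nu 0 = 0 -> nu 1 = 1 ->
  (forall i j : 'I_n.+1, (i <= j)%N -> P i -> P j) ->
  nu (\sum_(i | P i) s i) =
  \sum_(i < n.+1) (dual_value nu (lower_share s i.+1) - dual_value nu (lower_share s i))
         * (P i)%:R.
Proof.
move=> s1 nu0 nu1 Pup.
have -> : \sum_(i | P i) s i = 1 - \sum_(i | ~~ P i) s i.
  by rewrite -s1 [X in _ = X - _](bigID P)/= addrK.
have /= := value_lower_segment s (nu := dual_value nu) (P := fun i => ~~ P i).
rewrite dual_value0// => /(_ erefl) H.
rewrite -[LHS](subKr 1) -/(dual_value nu _) H; last first.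
  by move=> i j ij; apply: contra; exact: Pup.
rewrite -{1}(sum_lower_weights s1 (dual_value0 nu1) (dual_value1 nu0)) -sumrB.
by apply: eq_bigr => i _; case: (P i); rewrite /= ?mulr1 ?mulr0 ?subr0 ?subrr.
Qed.

(** * Summation by parts for the platforms *)

Lemma abel_sum (R : realType) (f X : nat -> R) (n : nat) :
  \sum_(i < n.+1) (f i.+1 - f i) * X i =
  f n.+1 * X n - f 0 * X 0 - \sum_(i < n) f i.+1 * (X i.+1 - X i).
Proof.
elim: n => [|n IHn]; first by rewrite big_ord_recr !big_ord0/=; ring.
by rewrite big_ord_recr/= IHn [in RHS]big_ord_recr/=; ring.
Qed.

Lemma x_lowE (R : realType) (n : nat) (x s : 'I_n.+1 -> R) (nu : R -> R) :
  \sum_i s i = 1 -> nu 0 = 0 -> nu 1 = 1 ->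
  x_low x s nu = x ord_max -
    \sum_(i < n) nu (lower_share s i.+1) * (x (inord i.+1) - x (inord i)).
Proof.
move=> s1 nu0 nu1.
(* [inord] extends the bliss points to all natural indices; only indices up to n matter, where it is
   faithful. *)
have := abel_sum (fun k => nu (lower_share s k)) (fun k => x (inord k)) n.
rewrite lower_share0 lower_share_full s1 nu0 nu1 mul1r mul0r subr0.
have -> : inord n = ord_max :> 'I_n.+1 by apply: val_inj; rewrite /= inordK.
by move=> <-; apply: eq_bigr => i _; rewrite inord_val.
Qed.

Lemma x_highE (R : realType) (n : nat) (x s : 'I_n.+1 -> R) (nu : R -> R) :
  \sum_i s i = 1 -> nu 0 = 0 -> nu 1 = 1 ->
  x_high x s nu = x ord0 +
    \sum_(i < n) nu (upper_share s i.+1) * (x (inord i.+1) - x (inord i)).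
Proof.
move=> s1 nu0 nu1; rewrite x_high_dual// x_lowE ?dual_value0 ?dual_value1//.
have -> : x ord_max = x ord0 + \sum_(i < n) (x (inord i.+1) - x (inord i)).
  rewrite -(big_mkord xpredT (fun i => x (inord i.+1) - x (inord i))) telescope_sumr//.
  have -> : inord n = ord_max :> 'I_n.+1 by apply: val_inj; rewrite /= inordK.
  have -> : inord 0 = ord0 :> 'I_n.+1 by apply: val_inj; rewrite /= inordK.
  by rewrite addrC subrK.
rewrite -addrA -sumrB; congr (_ + _); apply: eq_bigr => i _.
by rewrite lower_upper_share// /dual_value; ring.
Qed.

(** The boundary terms [x ord_max] of the two platforms cancel. The weight left on each gap is the
    excess over 1 of the joint value of two complementary groups, from which both positivity and
    strict comparison are read off. *)
Lemma platform_distanceE (R : realType) (n : nat) (x s : 'I_n.+1 -> R) (nu : R -> R) :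
  \sum_i s i = 1 -> nu 0 = 0 -> nu 1 = 1 ->
  platform_distance x s nu =
    \sum_(i < n) (nu (upper_share s i.+1) + nu (lower_share s i.+1) - 1)
                 * (x (inord i.+1) - x (inord i)).
Proof.
move=> s1 nu0 nu1.
rewrite /platform_distance (x_high_dual _ _ s1) !x_lowE ?dual_value0 ?dual_value1//.
rewrite opprB addrC addrA subrK -sumrB; apply: eq_bigr => i _.
by rewrite lower_upper_share// /dual_value; ring.
Qed.

(** The weights are nonnegative and sum to 1, so [x_low] is a convex combination of bliss points. *)
Lemma x_low_platform (R : realType) (n : nat) (x s : 'I_n.+1 -> R) (nu : R -> R) :
  (forall i j : 'I_n.+1, (i <= j)%N -> x i <= x j) ->
  (forall i, 0 < s i) -> \sum_i s i = 1 -> nu 0 = 0 -> nu 1 = 1 ->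
  {in `[0, 1] &, {homo nu : u v / u <= v}} ->
  platforms x (x_low x s nu).
Proof.
move=> x_nd s0 s1 nu0 nu1 nu_nd; rewrite /platforms/= in_itv/=.
have w0 (i : 'I_n.+1) : 0 <= nu (lower_share s i.+1) - nu (lower_share s i).
  by rewrite subr_ge0 nu_nd ?in_itv/= ?lower_share_bounds// le_lower_share.
rewrite -[x ord0]mul1r -[x ord_max]mul1r -!{1}(sum_lower_weights s1 nu0 nu1).
rewrite !mulr_suml; apply/andP; split; apply: ler_sum => i _; apply: ler_wpM2l => //.
  by apply: x_nd.
by apply: x_nd; rewrite -ltnS.
Qed.

Lemma dual_value_nondecreasing (R : realType) (nu : R -> R) :
  {in `[0, 1] &, {homo nu : u v / u <= v}} ->
  {in `[0, 1] &, {homo dual_value nu : u v / u <= v}}.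
Proof.
move=> nu_nd u v; rewrite !in_itv/= => /andP[u0 u1] /andP[v0 v1] uv.
rewrite /dual_value lerD2l lerN2 nu_nd ?in_itv/= ?lerD2l ?lerN2//.
all: by apply/andP; split; lra.
Qed.

(** * Expectations under the uniform shock *)

Lemma expectation_sum_indic d (T : measurableType d) (R : realType)
    (P : probability T R) (I : finType) (w : I -> R) (A : I -> set T) :
  (forall i, measurable (A i)) ->
  'E_P[fun e => (\sum_i w i * \1_(A i) e)%R]%E =
  (\sum_i w i * fine (P (A i)))%:E.
Proof.
move=> mA; rewrite unlock.
have iA i : P.-integrable setT (EFin \o \1_(A i)).
  by apply: integrable_indic => //; rewrite setIT fin_num_measure.
under eq_integral do rewrite -sumEFin.
rewrite integral_sum//; last first.
  move=> i; under eq_fun do rewrite EFinM.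
  exact: integrableZl (iA i).
rewrite -sumEFin; apply: eq_bigr => i _.
under eq_integral do rewrite EFinM.
rewrite integralZl//=; last exact: iA.
rewrite integral_indic// setIT EFinM fineK//.
exact: fin_num_measure.
Qed.

(** The threshold lies strictly inside the support, so the uniform cdf is not truncated and is
    affine in [d]. *)
Lemma shock_le (R : realType) (phi d : R) (phi_gt0 : 0 < phi) :
  `|d| < phi -> fine (shock phi_gt0 `]-oo, d]%classic) = 2^-1 + d / (phi *+ 2).
Proof.
rewrite ltr_norml => /andP[phid dphi].
rewrite /shock /= /uniform_prob integral_uniform_pdf.
have -> : `]-oo, d]%classic `&` `[- phi, phi]%classic = `[- phi, d]%classic :> set R.
  apply/seteqP; split=> z /=; rewrite !in_itv/=; first by case=> -> /andP[->].
  by move=> /andP[-> zd]; split => //=; rewrite (le_trans zd)// ltW.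
rewrite (eq_integral (fun=> (phi - - phi)^-1%:E)); last first.
  move=> z; rewrite inE/= in_itv/= /uniform_pdf => /andP[-> zd].
  by rewrite (le_trans zd)// ltW.
rewrite integral_cst//= lebesgue_measure_itv/= lte_fin phid -EFinB -EFinM/=.
by field; rewrite -?mulr2n; lra.
Qed.

Lemma shock_gt (R : realType) (phi d : R) (phi_gt0 : 0 < phi) :
  `|d| < phi -> fine (shock phi_gt0 `]d, +oo[%classic) = 2^-1 - d / (phi *+ 2).
Proof.
move=> dphi; rewrite -setCitvl probability_setC// fineB ?fin_num_measure//.
by rewrite shock_le//=; lra.
Qed.

(** * Reduction of expected payoffs to a single voter *)

(** The squares of the bliss points cancel in [delta], which is thus affine in the bliss point: its
    average is its value at the average bliss point. *)
Lemma weighted_delta (R : realType) (n : nat) (x w : 'I_n.+1 -> R) (a b : R) :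
  \sum_i w i = 1 ->
  let m := \sum_i w i * x i in
  \sum_i w i * delta x i a b = (b - m) ^+ 2 - (a - m) ^+ 2.
Proof.
move=> w1 m.
have -> : \sum_i w i * delta x i a b =
    \sum_i ((b ^+ 2 - a ^+ 2) * w i - (b - a) *+ 2 * (w i * x i)).
  by apply: eq_bigr => i _; rewrite /delta; ring.
by rewrite sumrB -!mulr_sumr w1 -/m; ring.
Qed.

Lemma delta_swap (R : realType) (n : nat) (x : 'I_n.+1 -> R) (i : 'I_n.+1) (a b : R) :
  delta x i b a = - delta x i a b.
Proof. by rewrite /delta opprB. Qed.

Lemma delta_nonincreasing (R : realType) (n : nat) (x : 'I_n.+1 -> R) (a b : R) :
  (forall i j : 'I_n.+1, (i <= j)%N -> x i <= x j) -> a <= b ->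
  forall i j : 'I_n.+1, (i <= j)%N -> delta x j a b <= delta x i a b.
Proof. by move=> x_nd ab i j /x_nd xij; rewrite /delta; nra. Qed.

Lemma delta_nondecreasing (R : realType) (n : nat) (x : 'I_n.+1 -> R) (a b : R) :
  (forall i j : 'I_n.+1, (i <= j)%N -> x i <= x j) -> b <= a ->
  forall i j : 'I_n.+1, (i <= j)%N -> delta x i a b <= delta x j a b.
Proof. by move=> x_nd ba i j /x_nd xij; rewrite /delta; nra. Qed.

(* The payoff of a party at y facing a rival at z is that of a party competing
   for a single voter, located at lo or hi according to the side of the rival. *)
Definition spatial_payoff (R : realType) (lo hi phi y z : R) : R :=
  let m := if y <= z then lo else hi in
  2^-1 + ((z - m) ^+ 2 - (y - m) ^+ 2) / (phi *+ 2).

Lemma spatial_payoff_le (R : realType) (lo hi phi y z : R) : y <= z ->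
  spatial_payoff lo hi phi y z =
  2^-1 + ((z - lo) ^+ 2 - (y - lo) ^+ 2) / (phi *+ 2).
Proof. by rewrite /spatial_payoff => ->. Qed.

Lemma spatial_payoff_ge (R : realType) (lo hi phi y z : R) : z <= y ->
  spatial_payoff lo hi phi y z =
  2^-1 + ((z - hi) ^+ 2 - (y - hi) ^+ 2) / (phi *+ 2).
Proof.
rewrite /spatial_payoff => zy; case: ifP => // yz.
(* At a tie both branches of [spatial_payoff] equal 1/2. *)
have -> : y = z by apply: le_anti; rewrite yz zy.
by rewrite !subrr.
Qed.

Lemma expectation_shock_le (R : realType) (n : nat) (x w : 'I_n.+1 -> R)
    (phi : R) (phi_gt0 : 0 < phi) (a b : R) :
  \sum_i w i = 1 -> (forall i, `|delta x i a b| < phi) ->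
  let m := \sum_i w i * x i in
  'E_(shock phi_gt0)[fun e => (\sum_i w i * (e <= delta x i a b)%R%:R)%R]%E =
  (2^-1 + ((b - m) ^+ 2 - (a - m) ^+ 2) / (phi *+ 2))%:E.
Proof.
move=> w1 dphi m; rewrite -weighted_delta//.
pose A i : set (measurableTypeR R) := `]-oo, delta x i a b]%classic.
transitivity ('E_(shock phi_gt0)[fun e => (\sum_i w i * \1_(A i) e)%R]%E).
  congr expectation; apply/funext => e; apply: eq_bigr => i _.
  by rewrite indicE /A mem_setE in_itv.
rewrite expectation_sum_indic; last by move=> i; exact: measurable_itv.
congr EFin.
(* The constant 1/2 is spread over the types with weights [w], so that each type contributes its own
   probability 1/2 + delta / (2 phi). *)
rewrite -[2^-1]mul1r -{1}w1 !mulr_suml -big_split/=; apply: eq_bigr => i _.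
by rewrite shock_le// mulrDr mulrA.
Qed.

Lemma expectation_shock_gt (R : realType) (n : nat) (x w : 'I_n.+1 -> R)
    (phi : R) (phi_gt0 : 0 < phi) (a b : R) :
  \sum_i w i = 1 -> (forall i, `|delta x i a b| < phi) ->
  let m := \sum_i w i * x i in
  'E_(shock phi_gt0)[fun e => (\sum_i w i * (delta x i a b < e)%R%:R)%R]%E =
  (2^-1 + ((a - m) ^+ 2 - (b - m) ^+ 2) / (phi *+ 2))%:E.
Proof.
move=> w1 dphi m; rewrite -weighted_delta//.
pose A i : set (measurableTypeR R) := `]delta x i a b, +oo[%classic.
transitivity ('E_(shock phi_gt0)[fun e => (\sum_i w i * \1_(A i) e)%R]%E).
  congr expectation; apply/funext => e; apply: eq_bigr => i _.
  by rewrite indicE /A mem_setE in_itv/= andbT.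
rewrite expectation_sum_indic; last by move=> i; exact: measurable_itv.
congr EFin.
rewrite -[2^-1]mul1r -{1}w1 !mulr_suml -big_split/=; apply: eq_bigr => i _.
by rewrite shock_gt// delta_swap; ring.
Qed.

(** * Equilibria of the single-voter game *)

Section spatial_equilibrium.
Context {R : realType}.
Variables (lo hi phi : R).
Hypotheses (lohi : lo < hi) (phi_gt0 : 0 < phi).

Let U := spatial_payoff lo hi phi.

Lemma ler_spatial_payoff_lo (y y' z : R) : y <= z -> y' <= z ->
  (U y z <= U y' z) = ((y' - lo) ^+ 2 <= (y - lo) ^+ 2).
Proof.
move=> yz y'z; rewrite /U !spatial_payoff_le// lerD2l ler_pM2r ?invr_gt0 ?mulrn_wgt0//.
by rewrite lerD2l lerN2.
Qed.

Lemma ler_spatial_payoff_hi (y y' z : R) : z <= y -> z <= y' ->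
  (U y z <= U y' z) = ((y' - hi) ^+ 2 <= (y - hi) ^+ 2).
Proof.
move=> zy zy'; rewrite /U !spatial_payoff_ge// lerD2l ler_pM2r ?invr_gt0 ?mulrn_wgt0//.
by rewrite lerD2l lerN2.
Qed.

(** To the left of the rival the voter sits at [lo], which is then optimal. To the right nothing
    beats [hi] itself, and [hi] also counts as a left position, so it is no better than [lo]. *)
Lemma spatial_payoff_hi (y : R) : U y hi <= U lo hi.
Proof.
have lohiW := ltW lohi; have [yh|/ltW hy] := leP y hi.
  by rewrite ler_spatial_payoff_lo// subrr expr0n/= sqr_ge0.
apply: (@le_trans _ _ (U hi hi)).
  by rewrite ler_spatial_payoff_hi// subrr expr0n/= sqr_ge0.
by rewrite ler_spatial_payoff_lo// subrr expr0n/= sqr_ge0.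
Qed.

Lemma spatial_payoff_lo (y : R) : U y lo <= U hi lo.
Proof.
have lohiW := ltW lohi; have [ly|/ltW yl] := leP lo y.
  by rewrite ler_spatial_payoff_hi// subrr expr0n/= sqr_ge0.
apply: (@le_trans _ _ (U lo lo)).
  by rewrite ler_spatial_payoff_lo// subrr expr0n/= sqr_ge0.
by rewrite ler_spatial_payoff_hi// subrr expr0n/= sqr_ge0.
Qed.

(** Imitating the rival must not pay, which forces lo <= z and y <= hi. Hence moving to [lo],
    respectively [hi], stays on the party's own side, and its unprofitability leaves no distance to
    that point. *)
Lemma spatial_equilibrium_lt (y z : R) :
  (forall y', y' = lo \/ y' = z -> U y' z <= U y z) ->
  (forall z', z' = hi \/ z' = y -> U z' y <= U z y) -> y < z ->
  y = lo /\ z = hi.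
Proof.
move=> Hy Hz yz; have yzW := ltW yz.
have := Hy z (or_intror erefl); rewrite ler_spatial_payoff_lo// => Hyz.
have := Hz y (or_intror erefl); rewrite ler_spatial_payoff_hi// => Hzy.
have lz : lo <= z by rewrite leNgt; apply/negP => zl; nra.
have yh : y <= hi by rewrite leNgt; apply/negP => hy; nra.
have := Hy lo (or_introl erefl); rewrite ler_spatial_payoff_lo// subrr expr0n/= => yl.
have := Hz hi (or_introl erefl); rewrite ler_spatial_payoff_hi// subrr expr0n/= => zh.
split; apply/eqP; rewrite -subr_eq0 -sqrf_eq0 eq_le sqr_ge0 andbT//.
Qed.

(** Only these three deviations are tested because they are feasible platforms in the actual game,
    where deviations are confined to a compact interval. *)
Lemma spatial_equilibrium (y z : R) :
  (forall y', y' = lo \/ y' = hi \/ y' = z -> U y' z <= U y z) ->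
  (forall z', z' = lo \/ z' = hi \/ z' = y -> U z' y <= U z y) ->
  (y = lo /\ z = hi) \/ (y = hi /\ z = lo).
Proof.
move=> Hy Hz; have [yz|zy|yz] := ltgtP y z.
- by left; apply: spatial_equilibrium_lt => // t [->|->]; [apply: Hy|apply: Hy|apply: Hz|apply: Hz]; auto.
- right; apply/and_comm; apply: spatial_equilibrium_lt => // t [->|->]; [apply: Hz|apply: Hz|apply: Hy|apply: Hy]; auto.
(* A common position cannot be both at least [hi] and at most [lo], so moving right to [hi] or left
   to [lo] pays. *)
- exfalso; rewrite yz in Hy; have [zh|hz] := ltP z hi.
    have := Hy hi (or_intror (or_introl erefl)).
    rewrite ler_spatial_payoff_hi ?(ltW zh)// subrr expr0n/=; nra.
  have lz : lo < z by exact: lt_le_trans hz.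
  have := Hy lo (or_introl erefl).
  rewrite ler_spatial_payoff_lo ?(ltW lz)// subrr expr0n/=; nra.
Qed.

Lemma spatial_payoff_lohi : U lo hi = 2^-1 + (hi - lo) ^+ 2 / (phi *+ 2).
Proof. by rewrite /U spatial_payoff_le ?(ltW lohi)// subrr expr0n/= subr0. Qed.

Lemma spatial_payoff_hilo : U hi lo = 2^-1 + (hi - lo) ^+ 2 / (phi *+ 2).
Proof. by rewrite /U spatial_payoff_ge ?(ltW lohi)// subrr expr0n/= subr0 -opprB sqrrN. Qed.

End spatial_equilibrium.

(** * Equilibria of the platform game *)

Section game.
Context {R : realType} {n : nat}.
Variables x s : 'I_n.+1 -> R.
Variable nu : R -> R.
Variables (phi : R) (phi_gt0 : 0 < phi).
Hypothesis x_nd : forall i j : 'I_n.+1, (i <= j)%N -> x i <= x j.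
Hypothesis s_gt0 : forall i, 0 < s i.
Hypothesis s_sum1 : \sum_i s i = 1.
Hypothesis phi_large : forall i a b, platforms x a -> platforms x b ->
  `|delta x i a b| < phi.
Hypothesis nu0 : nu 0 = 0.
Hypothesis nu1 : nu 1 = 1.

(** The supporters of A form a lower segment if a <= b and an upper one if b <= a. The corresponding
    weights average the bliss points to [x_low] and, through the dual value, to [x_high]. *)
Lemma payoff_AE (a b : R) : platforms x a -> platforms x b ->
  payoff_A x s nu phi_gt0 a b =
  (spatial_payoff (x_low x s nu) (x_high x s nu) phi a b)%:E.
Proof.
move=> Pa Pb; have dphi i := phi_large i Pa Pb.
rewrite /payoff_A; have [ab|/ltW ba] := leP a b.
- rewrite spatial_payoff_le// -(expectation_shock_le phi_gt0)//; last first.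
    exact: sum_lower_weights.
  congr expectation; apply/funext => e.
  rewrite /vote_share_A value_lower_segment// => i j ij ej.
  exact/(le_trans ej)/delta_nonincreasing.
- rewrite spatial_payoff_ge// x_high_dual// -(expectation_shock_le phi_gt0)//.
    congr expectation; apply/funext => e.
    rewrite /vote_share_A value_upper_segment// => i j ij ej.
    exact/(le_trans ej)/delta_nondecreasing.
  by apply: sum_lower_weights; rewrite ?dual_value0 ?dual_value1.
Qed.

Lemma payoff_BE (a b : R) : platforms x a -> platforms x b ->
  payoff_B x s nu phi_gt0 a b =
  (spatial_payoff (x_low x s nu) (x_high x s nu) phi b a)%:E.
Proof.
move=> Pa Pb; have dphi i := phi_large i Pa Pb.
(* Types indifferent at the shock vote for A, so the supporters of B are given by a strict
   inequality. *)
have shareB e : vote_share_B x s a b e = \sum_(i | delta x i a b < e) s i.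
  rewrite /vote_share_B /vote_share_A -s_sum1 [X in X - _](bigID (fun i => e <= delta x i a b))/=.
  by rewrite addrAC subrr add0r; apply: eq_bigl => i; rewrite ltNge.
rewrite /payoff_B; under eq_fun do rewrite shareB.
have [ab|/ltW ba] := leP a b.
- rewrite spatial_payoff_ge// x_high_dual// -(expectation_shock_gt phi_gt0)//.
    congr expectation; apply/funext => e.
    rewrite value_upper_segment// => i j ij.
    by apply: le_lt_trans; exact: delta_nonincreasing.
  by apply: sum_lower_weights; rewrite ?dual_value0 ?dual_value1.
- rewrite spatial_payoff_le// -(expectation_shock_gt phi_gt0)//; last first.
    exact: sum_lower_weights.
  congr expectation; apply/funext => e.
  rewrite value_lower_segment// => i j ij.
  by apply: le_lt_trans; exact: delta_nondecreasing.
Qed.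

Hypothesis nu_nd : {in `[0, 1] &, {homo nu : u v / u <= v}}.
Hypothesis low_lt_high : x_low x s nu < x_high x s nu.

Lemma platforms_x_low : platforms x (x_low x s nu).
Proof. exact: x_low_platform. Qed.

Lemma platforms_x_high : platforms x (x_high x s nu).
Proof.
rewrite x_high_dual//; apply: x_low_platform => //.
- exact: dual_value0.
- exact: dual_value1.
- exact: dual_value_nondecreasing.
Qed.

Lemma nash_low_high : nash x s nu phi_gt0 (x_low x s nu) (x_high x s nu).
Proof.
have Pl := platforms_x_low; have Ph := platforms_x_high.
split=> // [a' Pa'|b' Pb'].
- by rewrite !payoff_AE// lee_fin spatial_payoff_hi.
- by rewrite !payoff_BE// lee_fin spatial_payoff_lo.
Qed.

Lemma nash_platforms (a b : R) : nash x s nu phi_gt0 a b ->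
  (a = x_low x s nu /\ b = x_high x s nu) \/
  (a = x_high x s nu /\ b = x_low x s nu).
Proof.
have Pl := platforms_x_low; have Ph := platforms_x_high.
move=> [Pa Pb HA HB]; apply: (spatial_equilibrium low_lt_high phi_gt0).
- move=> y [|[|]] ->; rewrite -lee_fin -!payoff_AE//; exact: HA.
- move=> z [|[|]] ->; rewrite -lee_fin -!payoff_BE//; exact: HB.
Qed.

Lemma nash_distance (a b : R) : nash x s nu phi_gt0 a b ->
  `|b - a| = platform_distance x s nu.
Proof.
have d0 : 0 <= platform_distance x s nu by rewrite subr_ge0 ltW.
by move=> /nash_platforms[[-> ->]|[-> ->]]; last rewrite distrC; rewrite ger0_norm.
Qed.

(** Each party stands exactly at the voter relevant to its side, so its advantage is the squared
    distance of the rival from that voter, the same for both. *)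
Lemma nash_payoffs (a b : R) : nash x s nu phi_gt0 a b ->
  let v := (2^-1 + platform_distance x s nu ^+ 2 / (phi *+ 2))%:E in
  payoff_A x s nu phi_gt0 a b = v /\ payoff_B x s nu phi_gt0 a b = v.
Proof.
have Pl := platforms_x_low; have Ph := platforms_x_high.
by move=> /nash_platforms[[-> ->]|[-> ->]]; rewrite !payoff_AE// !payoff_BE//
  spatial_payoff_lohi// spatial_payoff_hilo.
Qed.

End game.

(** * Comparison of two affiliate-value distributions *)

Lemma party_value0 (R : realType) (G : probability (measurableTypeR R) R) (rho : R -> R) :
  party_value G rho 0 = 0.
Proof. by rewrite /party_value rel_power0 top_share0. Qed.

Lemma party_value1 (R : realType) (G : probability (measurableTypeR R) R) (rho : R -> R) :
  has_positive_continuous_density G -> power_rule rho -> party_value G rho 1 = 1.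
Proof. by move=> Gd rho_power; rewrite /party_value rel_power1// top_share1. Qed.

Lemma le_party_value (R : realType) (G : probability (measurableTypeR R) R) (rho : R -> R) :
  has_positive_continuous_density G -> power_rule rho ->
  {in `[0, 1] &, {homo party_value G rho : u v / u <= v}}.
Proof.
move=> Gd rho_power u v ui vi; rewrite le_eqVlt => /predU1P[->//|uv].
apply: le_top_share => //; rewrite ?in_itv/= ?rel_power_bounds//.
exact/ltW/lt_rel_power.
Qed.

(** Strict monotonicity of [rho] sends interior shares to interior relative power, and complementary
    shares to complementary power, so [top_share_complement] applies. *)
Lemma party_value_complement (R : realType) (G : probability (measurableTypeR R) R)
    (rho : R -> R) (u : R) :
  has_positive_continuous_density G -> power_rule rho -> 0 < u < 1 ->
  1 < party_value G rho u + party_value G rho (1 - u).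
Proof.
move=> Gd rho_power /andP[u0 u1]; rewrite /party_value rel_power_complement//; last first.
  by rewrite !ltW.
apply: top_share_complement => //.
have in0 : (0 : R) \in `[0, 1] by rewrite in_itv/= lexx ler01.
have in1 : (1 : R) \in `[0, 1] by rewrite in_itv/= lexx ler01.
have uin : u \in `[0, 1] by rewrite in_itv/= !ltW.
by rewrite -{1}(rel_power0 rho) -(rel_power1 rho_power) !lt_rel_power.
Qed.

Lemma x_low_lt_high (R : realType) (n : nat) (x s : 'I_n.+2 -> R) (nu : R -> R) :
  (forall i j : 'I_n.+2, (i < j)%N -> x i < x j) ->
  (forall i, 0 < s i) -> \sum_i s i = 1 -> nu 0 = 0 -> nu 1 = 1 ->
  (forall u, 0 < u < 1 -> 1 < nu u + nu (1 - u)) ->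
  x_low x s nu < x_high x s nu.
Proof.
move=> x_incr s0 s1 nu0 nu1 nuC; rewrite -subr_gt0 -/(platform_distance x s nu).
have term_gt0 (i : 'I_n.+1) :
    0 < (nu (upper_share s i.+1) + nu (lower_share s i.+1) - 1)
        * (x (inord i.+1) - x (inord i)).
  apply: mulr_gt0; rewrite subr_gt0.
    by rewrite lower_upper_share// addrC nuC// lower_share_interior//= ltnS.
  by apply: x_incr; rewrite !inordK// ltnS// ltnW.
(* With [n.+2] types there is at least one gap, whose term is positive. *)
rewrite platform_distanceE// (bigD1 ord0)//; apply: ltr_pwDl; first exact: term_gt0.
by apply: sumr_ge0 => i _; exact: ltW.
Qed.

(** After summation by parts [nu] enters [x_low] with nonpositive coefficients and [x_high] with
    nonnegative ones. *)
Lemma le_platforms (R : realType) (n : nat) (x s : 'I_n.+1 -> R) (nu nu' : R -> R) :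
  (forall i j : 'I_n.+1, (i <= j)%N -> x i <= x j) ->
  (forall i, 0 < s i) -> \sum_i s i = 1 ->
  nu 0 = 0 -> nu 1 = 1 -> nu' 0 = 0 -> nu' 1 = 1 ->
  {in `[0, 1], forall u, nu u <= nu' u} ->
  x_low x s nu' <= x_low x s nu /\ x_high x s nu <= x_high x s nu'.
Proof.
move=> x_nd s0 s1 nu0 nu1 nu'0 nu'1 le_nu.
have dx (i : 'I_n) : 0 <= x (inord i.+1) - x (inord i).
  by rewrite subr_ge0 x_nd// !inordK// ltnS// ltnW.
rewrite !x_lowE// !x_highE// lerD2l lerN2 lerD2l; split; apply: ler_sum => i _;
  apply: ler_wpM2r => //; apply: le_nu; rewrite in_itv/=.
  exact: lower_share_bounds.
have /andP[l0 l1] := lower_share_bounds i.+1 s0 s1.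
by rewrite lower_upper_share//; apply/andP; split; lra.
Qed.

Lemma lt_platform_distance (R : realType) (n : nat) (x s : 'I_n.+1 -> R)
    (nu nu' : R -> R) (i0 : 'I_n) :
  (forall i j : 'I_n.+1, (i < j)%N -> x i < x j) ->
  (forall i, 0 < s i) -> \sum_i s i = 1 ->
  nu 0 = 0 -> nu 1 = 1 -> nu' 0 = 0 -> nu' 1 = 1 ->
  {in `[0, 1], forall u, nu u <= nu' u} ->
  nu (upper_share s i0.+1) + nu (lower_share s i0.+1) <
    nu' (upper_share s i0.+1) + nu' (lower_share s i0.+1) ->
  platform_distance x s nu < platform_distance x s nu'.
Proof.
move=> x_incr s0 s1 nu0 nu1 nu'0 nu'1 le_nu lt_i0.
have dx (i : 'I_n) : 0 < x (inord i.+1) - x (inord i).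
  by rewrite subr_gt0 x_incr// !inordK// ltnS// ltnW.
rewrite !platform_distanceE// (bigD1 i0)//= [X in _ < X](bigD1 i0)//=.
apply: ltr_leD; first by rewrite ltr_pM2r// ltrD2r.
apply: ler_sum => i _; rewrite ler_pM2r// lerD2r.
have /andP[l0 l1] := lower_share_bounds i.+1 s0 s1.
by apply: lerD; apply: le_nu; rewrite in_itv/= ?lower_upper_share//; apply/andP; split; lra.
Qed.

Theorem propositionA1 (R : realType) (n : nat) (x s : 'I_n.+2 -> R)
    (phi : R) (phi_gt0 : 0 < phi) (rho : R -> R)
    (GL GH : probability (measurableTypeR R) R)
    (x_incr : forall i j : 'I_n.+2, (i < j)%N -> x i < x j)
    (s_gt0 : forall i, 0 < s i)
    (s_sum1 : \sum_i s i = 1)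
    (phi_large : forall i a b, platforms x a -> platforms x b ->
       `|delta x i a b| < phi)
    (rho_power : power_rule rho)
    (GL_aff : affiliate_distribution GL)
    (GH_aff : affiliate_distribution GH)
    (GL_dens : has_positive_continuous_density GL)
    (GH_dens : has_positive_continuous_density GH)
    (same_mean : mean GL = mean GH)
    (GH_conc : more_concentrated GH GL) :
  let nuL := party_value GL rho in
  let nuH := party_value GH rho in
  [/\ [/\ x_low x s nuH <= x_low x s nuL,
          x_low x s nuL < x_high x s nuL &
          x_high x s nuL <= x_high x s nuH],
      platform_distance x s nuL <= platform_distance x s nuH,
      (exists a b, nash x s nuL phi_gt0 a b) /\
      (exists a b, nash x s nuH phi_gt0 a b),
      forall aL bL aH bH,
        nash x s nuL phi_gt0 aL bL -> nash x s nuH phi_gt0 aH bH ->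
        [/\ `|bL - aL| <= `|bH - aH|,
            (payoff_A x s nuL phi_gt0 aL bL <= payoff_A x s nuH phi_gt0 aH bH)%E &
            (payoff_B x s nuL phi_gt0 aL bL <= payoff_B x s nuH phi_gt0 aH bH)%E] &
      (exists i j : 'I_n.+2,
         [/\ i = j.+1 :> nat, x j < x i &
             let ri := rel_power rho (upper_share s i) in
             0 < (top_share GH ri - top_share GL ri)
                 + (top_share GH (1 - ri) - top_share GL (1 - ri))]) ->
      platform_distance x s nuL < platform_distance x s nuH /\
      forall aL bL aH bH,
        nash x s nuL phi_gt0 aL bL -> nash x s nuH phi_gt0 aH bH ->
        `|bL - aL| < `|bH - aH|].
Proof.
move=> nuL nuH.
have x_nd (i j : 'I_n.+2) : (i <= j)%N -> x i <= x j.
  by rewrite leq_eqVlt => /predU1P[/val_inj->//|/x_incr/ltW].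
have [L0 H0] : nuL 0 = 0 /\ nuH 0 = 0 by split; exact: party_value0.
have [L1 H1] : nuL 1 = 1 /\ nuH 1 = 1 by split; exact: party_value1.
have L_nd : {in `[0, 1] &, {homo nuL : u v / u <= v}} by exact: le_party_value.
have H_nd : {in `[0, 1] &, {homo nuH : u v / u <= v}} by exact: le_party_value.
have le_LH : {in `[0, 1], forall u, nuL u <= nuH u}.
  by move=> u u01; apply: GH_conc; rewrite in_itv/= rel_power_bounds.
have ltL : x_low x s nuL < x_high x s nuL.
  by apply: x_low_lt_high => // u; exact: party_value_complement.
have ltH : x_low x s nuH < x_high x s nuH.
  by apply: x_low_lt_high => // u; exact: party_value_complement.
have [le_low le_high] := le_platforms x_nd s_gt0 s_sum1 L0 L1 H0 H1 le_LH.
have le_dist : platform_distance x s nuL <= platform_distance x s nuH.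
  exact: lerB.
have distL := nash_distance (phi_gt0 := phi_gt0) x_nd s_gt0 s_sum1 phi_large L0 L1 L_nd ltL.
have distH := nash_distance (phi_gt0 := phi_gt0) x_nd s_gt0 s_sum1 phi_large H0 H1 H_nd ltH.
split=> //.
- by split; do 2 eexists; apply: nash_low_high.
- move=> aL bL aH bH NL NH; rewrite (distL _ _ NL) (distH _ _ NH).
  have [-> ->] := nash_payoffs x_nd s_gt0 s_sum1 phi_large L0 L1 L_nd ltL NL.
  have [-> ->] := nash_payoffs x_nd s_gt0 s_sum1 phi_large H0 H1 H_nd ltH NH.
  have d0 : 0 <= platform_distance x s nuL by rewrite subr_ge0 ltW.
  have le_v : 2^-1 + platform_distance x s nuL ^+ 2 / (phi *+ 2) <=
              2^-1 + platform_distance x s nuH ^+ 2 / (phi *+ 2).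
    rewrite lerD2l ler_pM2r ?invr_gt0 ?mulrn_wgt0//.
    by rewrite lerXn2r ?nnegrE// (le_trans d0).
  by rewrite !lee_fin.
- move=> [i [j [ij xji]]] /= gap.
  (* The gap between types [j] and [i] has index [j] in the sum for the distance, and its cumulative
     shares are taken at [j.+1], that is at [i]. *)
  have jn : (j < n.+1)%N by rewrite -ltnS -ij.
  have /andP[l0 l1] := lower_share_bounds i s_gt0 s_sum1.
  have lt_dist : platform_distance x s nuL < platform_distance x s nuH.
    apply: (lt_platform_distance (i0 := Ordinal jn)) => //=.
    (* Writing the lower share as 1 minus the upper share turns its relative power into 1 - r_i, as
       in the assumed inequality. *)
    rewrite -ij -(subKr 1 (lower_share s i)) -lower_upper_share//.
    rewrite /nuL /nuH /party_value rel_power_complement//; first lra.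
    by rewrite lower_upper_share//; apply/andP; split; lra.
  by split=> // aL bL aH bH NL NH; rewrite (distL _ _ NL) (distH _ _ NH).
Qed.
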